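(* Let $n\geq 3$ and $1\leq k<n$ be integers, and let $X=(k,n)=\{k+1,\dots,n-1\}$. Then the characteristic polynomial of the hyperplane arrangement $$\mathcal{A}^{X}=\{C_{ij}:1\leq i<j\leq n\}\cup\{S_{ij}: i\in X,\ i<j\leq n\}\cup\{I_{ij}: i\in[n]\setminus X,\ i<j\leq n\}$$ in $\mathbb{R}^n$ is $$\chi(\mathcal{A}^{(k,n)},q)=q(q-n)^{n-1}.$$
   Context: For $1\leq i<j\leq n$ define the hyperplanes of $\mathbb{R}^n$: $C_{ij}=\{x\in\mathbb{R}^n: x_i=x_j\}$, $S_{ij}=\{x: x_i=x_j+1\}$, $I_{ij}=\{x: x_1=x_j+i\}$. Here $[n]=\{1,\dots,n\}$. In particular $\mathcal{A}^{(1,n)}$ is the Shi arrangement and $\mathcal{A}^{(n-1,n)}=\mathcal{A}^{\varnothing}$ is the Ish arrangement. The characteristic polynomial of an arrangement $\mathcal{A}$ in $\mathbb{R}^n$ is $\chi(\mathcal{A},q)=\sum_{\mathcal{B}}(-1)^{|\mathcal{B}|}q^{\dim\bigcap\mathcal{B}}$, the sum over subsets $\mathcal{B}\subseteq\mathcal{A}$ with $\bigcap\mathcal{B}\neq\varnothing$ (the empty intersection being $\mathbb{R}^n$). *)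

(* Defs.v *)
From HB Require Import structures.
From mathcomp Require Import all_boot all_order all_algebra.
From mathcomp Require Import finmap.
From mathcomp Require Import boolp classical_sets reals.

Set Implicit Arguments.
Unset Strict Implicit.
Unset Printing Implicit Defensive.

Import Order.TTheory GRing.Theory Num.Theory.

Local Open Scope classical_set_scope.
Local Open Scope ring_scope.

Section CharacteristicPolynomial.
Variables (R : realType) (n : nat).

Definition has_affdim (F : set 'rV[R]_n) (d : nat) : Prop :=
  exists (p : 'rV[R]_n) (U : {vspace 'rV[R]_n}),
    F = [set x | x - p \in U] /\ \dim U = d.

Lemma has_affdim_unique (F : set 'rV[R]_n) (d e : nat) :
  has_affdim F d -> has_affdim F e -> d = e.
Proof.
move=> [p [U [FU <-]]] [q [V [FV <-]]].
have inF x : x - p \in U <-> x - q \in V.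
  by move: (congr1 (@^~ x) FU) (congr1 (@^~ x) FV) => /= -> ->.
have pq : p - q \in V by apply/inF; rewrite subrr mem0v.
congr (\dim _); apply/vspaceP => v; apply/idP/idP => hv.
  have /inF h : v + p - p \in U by rewrite addrK.
  by rewrite -(addrK (p - q) v) addrA rpredB.
have /inF : v + p - q \in V by rewrite -addrA rpredD.
by rewrite addrK.
Qed.

(* Junk value 0 when F is not an affine subspace (in particular if empty). *)
Definition affdim (F : set 'rV[R]_n) : nat := xget 0%N [set d | has_affdim F d].

Definition intersection (B : {fset set 'rV[R]_n}) : set 'rV[R]_n :=
  \bigcap_(H in [set` B]) H.

Definition char_poly_arr (A : {fset set 'rV[R]_n}) : {poly int} :=
  \sum_(B <- fpowerset A | intersection B != set0)
    (-1) ^+ #|` B| * 'X^(affdim (intersection B)).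

End CharacteristicPolynomial.

(* Coordinates are indexed by 'I_n = {0, ..., n-1}: the ordinal i stands for
   the index i.+1 of [n] = {1, ..., n}. *)
Section ShiIsh.
Variables (R : realType) (n : nat).

Definition first_ord (i : 'I_n) : 'I_n :=
  Ordinal (leq_ltn_trans (leq0n i) (ltn_ord i)).

Definition hypC (i j : 'I_n) : set 'rV[R]_n := [set x | x 0 i = x 0 j].

Definition hypS (i j : 'I_n) : set 'rV[R]_n := [set x | x 0 i = x 0 j + 1].

Definition hypI (i j : 'I_n) : set 'rV[R]_n :=
  [set x | x 0 (first_ord j) = x 0 j + i.+1%:R].

Definition arrangement (X : {set 'I_n}) : {fset set 'rV[R]_n} :=
  ([fset hypC p.1 p.2 | p in [pred p : 'I_n * 'I_n |
      (p.1 < p.2)%N]] `|`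
   [fset hypS p.1 p.2 | p in [pred p : 'I_n * 'I_n |
      (p.1 \in X) && (p.1 < p.2)%N]] `|`
   [fset hypI p.1 p.2 | p in [pred p : 'I_n * 'I_n |
      (p.1 \notin X) && (p.1 < p.2)%N]])%fset.

End ShiIsh.

(* (k, n) = {k+1, ..., n-1} as a subset of [n] *)
Definition open_int (n k : nat) : {set 'I_n} := [set i : 'I_n | (k < i.+1 < n)%N]%SET.

(* Main.v *)
Require Import Defs.
From mathcomp Require Import all_boot all_order all_algebra.
From mathcomp Require Import finmap zify ring.
From mathcomp Require Import boolp classical_sets reals.

Set Implicit Arguments.
Unset Strict Implicit.
Unset Printing Implicit Defensive.

Import Order.TTheory GRing.Theory Num.Theory.

(** Finite field method, over Z/m for all large m. Every system of equations
    x_i = x_j + c is equivalent, over all commutative rings at once, either to a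
    system x_i = x_(r i) + h_i with r idempotent, or to one that implies w = 0
    for a nonzero integer w. Hence a subarrangement has m^dim solutions in
    (Z/m)^n, or none if its intersection is empty, and by inclusion-exclusion
    chi(m) is the number of points of (Z/m)^n that lie on no hyperplane.

    To count these points, choose x_1 (m ways) and put z_j = x_j - x_1 - 1. The
    conditions with x_1 say that z_j < m - 1 - min(k, j - 1), so that all values
    lie on a line of cells. The smallest label can be removed: when i <= k, it
    occupies any cell that the larger labels leave free; when i > k, the cell
    before it is not occupied by a larger label, and removing its cell leaves a
    configuration of the other labels on one cell less. In both cases there are
    m - n ways to put it back. *)

(** * Counting Shi-Ish configurations *)

Lemma card_in_can (T U : finType) (A : {set T}) (B : {set U})
    (f : T -> U) (g : U -> T) :
  {in A, forall x, f x \in B} -> {in B, forall y, g y \in A} ->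
  {in A, cancel f g} -> {in B, cancel g f} -> #|A| = #|B|.
Proof.
move=> fB gA fK gK; rewrite -(card_in_imset (can_in_inj fK)); congr #|pred_of_set _|.
apply/setP => y; apply/imsetP/idP => [[x xA ->]|yB]; first exact: fB.
by exists (g y); [exact: gA | rewrite gK].
Qed.

Section Fcons.
Variables (T : Type) (N : nat).

Definition fcons (p : T) (w : {ffun 'I_N -> T}) : {ffun 'I_N.+1 -> T} :=
  [ffun a => oapp w p (unlift ord0 a)].

Definition ftail (y : 'I_N.+1 -> T) : {ffun 'I_N -> T} :=
  [ffun a => y (lift ord0 a)].

Lemma fcons0 p w : fcons p w ord0 = p.
Proof. by rewrite ffunE unlift_none. Qed.

Lemma fconsS p w a : fcons p w (lift ord0 a) = w a.
Proof. by rewrite ffunE liftK. Qed.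

Lemma fcons_tail (y : {ffun 'I_N.+1 -> T}) : fcons (y ord0) (ftail y) = y.
Proof.
apply/ffunP => a; case: (unliftP ord0 a) => [b|] ->.
  by rewrite fconsS ffunE.
by rewrite fcons0.
Qed.

Lemma forall_ordS (P : 'I_N.+1 -> Prop) :
  (forall a, P a) <-> P ord0 /\ forall a, P (lift ord0 a).
Proof.
split=> [h|[h0 hS] a]; first by split.
by case: (unliftP ord0 a) => [b|] ->.
Qed.

End Fcons.

Section ShiIshCount.
Variables (s K : nat).

(* Placements of the N largest labels of [n] on M cells. The label of index a
   is n - N + 1 + a; those of index a >= N - s are the labels i > k, to which
   the Shi conditions x_i <> x_j + 1 apply, where s = n - k. The upper bounds on
   [z a] are the Ish conditions together with x_1 <> x_j. *)
Definition shi_ish N M (z : {ffun 'I_N -> 'I_K.+1}) : bool :=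
  [forall a : 'I_N, z a < M - minn a (N - s)] &&
  [forall a : 'I_N, forall b : 'I_N, (a < b) ==>
     (z a != z b) && ((N - s <= a) ==> (z a != (z b).+1 :> nat))].

Lemma shi_ishP N M (z : {ffun 'I_N -> 'I_K.+1}) :
  reflect ((forall a : 'I_N, z a < M - minn a (N - s)) /\
           (forall a b : 'I_N, a < b -> z a <> z b :> nat /\
              (N - s <= a -> z a <> (z b).+1 :> nat)))
          (shi_ish M z).
Proof.
apply: (iffP andP) => -[h1 h2].
  split=> [a|a b ab]; first by move/forallP: h1.
  move/forallP/(_ a)/forallP/(_ b)/implyP/(_ ab)/andP: h2 => [h3 h4].
  split=> [/val_inj e|h5]; first by rewrite e eqxx in h3.
  by apply/eqP; move/implyP: h4; apply.
split; first exact/forallP.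
apply/forallP => a; apply/forallP => b; apply/implyP => /h2[h3 h4].
apply/andP; split; first by apply/eqP => e; apply: h3; rewrite e.
by apply/implyP => /h4 /eqP.
Qed.

Lemma shi_ish_inj N M (z : {ffun 'I_N -> 'I_K.+1}) :
  shi_ish M z -> injective z.
Proof.
move=> /shi_ishP[_ h] a b e; case: (ltngtP a b) => [/h[]|/h[]|/val_inj //];
  by rewrite e.
Qed.

(* Removing the smallest label 0 at [p] from a Shi configuration also removes
   its cell, so that the cells above [p] move down by one; an Ish
   configuration keeps its cells. *)
Definition insert_cell N p x := if N < s then bump p x else x.
Definition remove_cell N p x := if N < s then unbump p x else x.

Definition insertable N (p : nat) (z : {ffun 'I_N -> 'I_K.+1}) : bool :=
  [forall a, p != (N < s) + z a :> nat].

(** If [N < s], every label is a Shi label and the bounds are just the number of cells. Insertion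
    changes only the differences of cells separated by [p]; it would hide a violation
    [z a = z b + 1] only for [p = z b + 1], which [insertable] excludes. If [s <= N], the subtracted
    minima of the larger labels grow by one, which cancels the passage from [M] to [M.+1]. *)
Lemma shi_ish_fcons N M (p : 'I_K.+1) (w z : {ffun 'I_N -> 'I_K.+1}) :
  (forall a, w a = insert_cell N p (z a) :> nat) ->
  shi_ish M.+1 (fcons p w) = [&& p < M.+1, insertable p z & shi_ish M z].
Proof.
rewrite /insert_cell => wE; apply/shi_ishP/and3P.
  move=> -[/forall_ordS[]]; rewrite fcons0 => h0 hS h.
  have h1 (a : 'I_N) : w a < M.+1 - minn a.+1 (N.+1 - s).
    by have := hS a; rewrite fconsS.
  have h2 (a : 'I_N) : p <> w a :> nat /\ (N.+1 - s <= 0 -> p <> (w a).+1 :> nat).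
    by have := h ord0 (lift ord0 a) isT; rewrite fcons0 fconsS.
  have h3 (a b : 'I_N) : a < b -> w a <> w b :> nat /\
      (N.+1 - s <= a.+1 -> w a <> (w b).+1 :> nat).
    by move=> ab; have := h (lift ord0 a) (lift ord0 b) ab; rewrite !fconsS.
  clear h hS; split.
  - by have := h0; lia.
  - apply/forallP => a; apply/eqP.
    by case: (h2 a); have := wE a; rewrite /bump; case: ifP; lia.
  apply/shi_ishP; split=> [a|a b ab].
    have := wE a; have := h1 a; case: (h2 a); have := ltn_ord a; rewrite /bump.
    by case: ifP; lia.
  case: (h3 a b ab); case: (h2 a); case: (h2 b).
  by have := wE a; have := wE b; rewrite /bump; case: ifP; lia.
move=> [pM /forallP ins /shi_ishP[h1 h2]].
have ins' a : p <> (N < s) + z a :> nat by apply/eqP.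
clear ins; split.
  apply/forall_ordS; rewrite fcons0; split; first by rewrite min0n subn0.
  move=> a; rewrite fconsS lift0 wE.
  by have := h1 a; have := ins' a; have := ltn_ord a; rewrite /bump; case: ifP; lia.
move=> a b; case: (unliftP ord0 a) => [a'|] ->; case: (unliftP ord0 b) => [b'|] ->;
  rewrite ?fconsS ?fcons0 ?lift0 //.
  move=> ab; case: (h2 a' b' ab); have := ins' a'; have := ins' b'.
  by rewrite !wE /bump; case: ifP; lia.
by have := ins' b'; rewrite wE /bump /=; case: ifP => /=; lia.
Qed.

(** The excluded values [(N < s) + z a] are [N] distinct cells, all at most [M], so the count is the
    same for every [z]. *)
Lemma card_insertable N M (z : {ffun 'I_N -> 'I_K.+1}) :
  M <= K -> shi_ish M z ->
  #|[set p : 'I_K.+1 | (p < M.+1) && insertable p z]| = M.+1 - N.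
Proof.
move=> MK zM; have zinj := shi_ish_inj zM; have [zlt _] := shi_ishP _ _ zM.
have fK a : (N < s) + z a < K.+1 by have := zlt a; lia.
pose f a : 'I_K.+1 := Ordinal (fK a).
have finj : injective f.
  by move=> a b /(congr1 val) /= /addnI /val_inj /zinj.
have cM : #|[set p : 'I_K.+1 | p < M.+1]| = M.+1.
  pose g (p : 'I_M.+1) := widen_ord (MK : M.+1 <= K.+1) p.
  have ginj : injective g by move=> p q /(congr1 val) /= /val_inj.
  rewrite -[RHS]card_ord -(card_imset _ ginj); congr #|pred_of_set _|.
  apply/setP => p; rewrite inE; apply/idP/imsetP => [pM|[q _ ->]] //=.
  by exists (Ordinal pM) => //; apply: val_inj.
rewrite -[in RHS]cM -[X in _ - X]card_ord -(card_imset _ finj).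
have sub : f @: 'I_N \subset [set p : 'I_K.+1 | p < M.+1].
  by apply/fintype.subsetP => _ /imsetP[a _ ->]; rewrite inE /=; have := zlt a; lia.
rewrite -(cardsDS sub); congr #|pred_of_set _|; apply/setP => p.
rewrite !inE andbC; congr (_ && _); apply/forallP/negP => [h /imsetP[a _ e]|h a].
  by have := h a; rewrite e /= eqxx.
by apply/eqP => e; apply: h; apply/imsetP; exists a => //; apply: val_inj.
Qed.

(** Removing a label lowers [N] and [M] together, so [M.+1 - N] is invariant and every label
    contributes this same factor. *)
Lemma card_shi_ish N M : M <= K.+1 ->
  #|[set z : {ffun 'I_N -> 'I_K.+1} | shi_ish M z]| = (M.+1 - N) ^ N.
Proof.
elim: N M => [|N IH] M MK.
  rewrite expn0 (_ : [set _ | _] = [set: {ffun 'I_0 -> 'I_K.+1}]%SET)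
    ?cardsT ?card_ffun ?card_ord ?expn0 //.
  apply/setP => z; rewrite !inE; apply/shi_ishP.
  by split=> -[].
(* With a label to place and no cell, both sides are 0, the right one by truncated subtraction. *)
case: M MK => [_|M MK].
  rewrite subSS sub0n exp0n //; apply/eqP; rewrite cards_eq0; apply/eqP/setP => z.
  rewrite !inE; apply/shi_ishP => -[/(_ ord0)].
  by rewrite sub0n.
pose D := [set u : 'I_K.+1 * {ffun 'I_N -> 'I_K.+1} |
            [&& u.1 < M.+1, insertable u.1 u.2 & shi_ish M u.2]].
pose G (u : 'I_K.+1 * {ffun 'I_N -> 'I_K.+1}) :=
  fcons u.1 [ffun a => inord (insert_cell N u.1 (u.2 a)) : 'I_K.+1].
pose F (y : {ffun 'I_N.+1 -> 'I_K.+1}) : 'I_K.+1 * {ffun 'I_N -> 'I_K.+1} :=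
  (y ord0, [ffun a => inord (remove_cell N (y ord0) (y (lift ord0 a))) : 'I_K.+1]).
have insK p x : remove_cell N p (insert_cell N p x) = x.
  by rewrite /remove_cell /insert_cell; case: (N < s); rewrite ?bumpK.
(* The default of [inord] is never reached: the cells of [z] lie below [M], and [M <= K], so a
   shifted cell is still at most [K]. *)
have Gval p z : (p, z) \in D -> forall a,
    (inord (insert_cell N p (z a)) : 'I_K.+1) = insert_cell N p (z a) :> nat.
  rewrite inE => /and3P[/= pM _ /shi_ishP[zM _]] a; rewrite inordK //.
  by have := zM a; rewrite /insert_cell /bump /=; case: ifP => _; lia.
have Fval y : shi_ish M.+1 y -> forall a, y (lift ord0 a) =
    insert_cell N (y ord0) (inord (remove_cell N (y ord0) (y (lift ord0 a))) : 'I_K.+1) :> nat.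
  move=> /shi_ishP[yM yd] a.
  have [h _] := yd ord0 (lift ord0 a) isT.
  have := ltn_ord (y (lift ord0 a)) => yK.
  rewrite inordK /remove_cell /insert_cell; last by rewrite /unbump; case: ifP; lia.
  case: (N < s) => //.
  by rewrite unbumpK //; apply/eqP => e; apply: h.
have -> : #|[set y : {ffun 'I_N.+1 -> 'I_K.+1} | shi_ish M.+1 y]| = #|D|.
  apply: (@card_in_can _ _ _ _ F G).
  - move=> y; rewrite !inE /= => yM; rewrite -(@shi_ish_fcons _ _ _ (ftail y)).
      by rewrite fcons_tail.
    by move=> a; rewrite !ffunE; apply: Fval.
  - move=> [p z] pz; rewrite inE /G (@shi_ish_fcons _ _ _ _ z).
      by move: pz; rewrite inE.
    by move=> a; rewrite ffunE; apply: Gval.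
  - move=> y; rewrite inE => yM; rewrite -[RHS]fcons_tail /G /F /=.
    congr fcons; apply/ffunP => a; rewrite !ffunE; apply: val_inj => /=.
    by rewrite -Fval // inord_val.
  - move=> [p z] pz; rewrite /F /G /= fcons0; congr (_, _); apply/ffunP => a.
    rewrite !ffunE liftK /= ffunE; apply: val_inj => /=.
    by rewrite (Gval _ _ pz) insK inord_val.
have MK' : M <= K by [].
rewrite subSS -sum1_card expnS -(IH M) //; last exact: ltnW.
rewrite mulnC -sum_nat_const.
transitivity (\sum_(z in [set z : {ffun 'I_N -> 'I_K.+1} | shi_ish M z])
   \sum_(p in [set p : 'I_K.+1 | (p < M.+1) && insertable p z]) 1).
  rewrite pair_big_dep /= [RHS](reindex (fun u : 'I_K.+1 * {ffun 'I_N -> 'I_K.+1} =>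
    (u.2, u.1))) /=; last by exists (fun u => (u.2, u.1)) => -[].
  by apply: eq_bigl => -[p z]; rewrite !inE /= andbA andbC.
by apply: eq_bigr => z; rewrite inE => zM; rewrite sum1_card card_insertable.
Qed.

End ShiIshCount.

Local Open Scope ring_scope.

(** * Systems of equations x_i = x_j + c *)

Definition sat (n : nat) (V : comNzRingType) (x : 'I_n -> V)
    (t : 'I_n * 'I_n * 'I_n) : bool :=
  x t.1.1 == x t.1.2 + t.2%:R.

Section NormalForm.
Variable n : nat.
Implicit Types (r : 'I_n -> 'I_n) (h : 'I_n -> int) (L : seq ('I_n * 'I_n * 'I_n)).

Definition solved (V : comNzRingType) r h (x : 'I_n -> V) : Prop :=
  forall i, x i = x (r i) + (h i)%:~R.

(** Induction on the equations, as in union-find: [r] sends an index to the representative of its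
    class and [h] is the offset from it. An equation inside one class is either automatic or forces
    a nonzero integer to vanish; an equation between two classes merges them. The ring is quantified
    last, so that the same [r], [h] or [w] serve the reals and all Z/m. *)
Lemma normal_form L :
  (exists r h, [/\ forall i, r (r i) = r i, forall i, h (r i) = 0 &
     forall (V : comNzRingType) (x : 'I_n -> V), all (sat x) L <-> solved r h x])
  \/ (exists2 w : int, w <> 0 &
     forall (V : comNzRingType) (x : 'I_n -> V), all (sat x) L -> w%:~R = 0 :> V).
Proof.
elim: L => [|[[i j] c] L].
  left; exists id, (fun=> 0); split=> // V x; split=> // _ a.
  by rewrite addr0.
case=> [[r [h [rr hr eqv]]]|[w w0 hw]]; last first.
  by right; exists w => // V x /= /andP[_ /hw].
have [eqr|neqr] := eqVneq (r i) (r j).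
  have [eqh|neqh] := eqVneq (h i) (h j + c%:Z).
    left; exists r, h; split=> // V x /=; split=> [/andP[_ /eqv //]|sx].
    apply/andP; split; last exact/eqv.
    by apply/eqP; rewrite /= (sx i) (sx j) eqr eqh intrD -addrA.
  right; exists (h i - (h j + c%:Z)); first by apply/eqP; rewrite subr_eq0.
  move=> V x /= /andP[/eqP /= e /eqv sx].
  move: e; rewrite (sx i) (sx j) eqr -addrA => /addrI e.
  by rewrite intrB intrD e subrr.
(* The offset that the new equation forces between the two representatives:
   [x (r i) = x (r j) + d]. *)
pose d := h j + c%:Z - h i.
left; exists (fun a => if r a == r i then r j else r a),
             (fun a => if r a == r i then h a + d else h a).
split=> [a|a|V x].
- case: (altP (r a =P r i)) => ra; first by rewrite rr eq_sym (negPf neqr).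
  by rewrite rr (negPf ra).
- case: (altP (r a =P r i)) => ra; first by rewrite rr eq_sym (negPf neqr) hr.
  by rewrite rr (negPf ra) hr.
split=> [/= /andP[/eqP /= e /eqv sx] a|sx].
  case: ifP => [/eqP ra|_]; last exact: sx.
  have {}e : x (r i) = x (r j) + d%:~R.
    move: e; rewrite (sx i) (sx j) /d intrB intrD => e.
    by apply: (addIr (h i)%:~R); rewrite e -pmulrn; ring.
  by rewrite (sx a) ra e intrD; ring.
have e : x (r i) = x (r j) + d%:~R.
  by have := sx (r i); rewrite rr eqxx hr add0r.
have {}sx : solved r h x.
  move=> a; have := sx a; case: (altP (r a =P r i)) => // -> ->.
  by rewrite e intrD; ring.
apply/andP; split; last exact/eqv.
by apply/eqP; rewrite /= (sx i) (sx j) e /d intrB intrD -pmulrn; ring.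
Qed.

(** The values at the fixed points of [r] are arbitrary and determine all the others. *)
Lemma card_solved (V : finComNzRingType) r h :
  (forall i, r (r i) = r i) -> (forall i, h (r i) = 0) ->
  #|[set y : {ffun 'I_n -> V} | `[< solved r h y >]]| =
    (#|V| ^ #|[pred i | r i == i]|)%N.
Proof.
move=> rr hr; pose I := {i | r i == i}.
have rI i : r (r i) == r i by rewrite rr.
transitivity #|[set: {ffun I -> V}]%SET|; last by rewrite cardsT card_ffun card_sig.
pose f (y : {ffun 'I_n -> V}) : {ffun I -> V} := [ffun u : I => y (val u)].
pose g (z : {ffun I -> V}) : {ffun 'I_n -> V} :=
  [ffun i => (z (exist _ (r i) (rI i)) + (h i)%:~R : V)].
apply: (@card_in_can _ _ _ _ f g).
- by move=> y _; rewrite inE.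
- move=> z _; rewrite inE; apply/asboolP => i; rewrite !ffunE hr addr0.
  by congr (z _ + _); apply: val_inj => /=; rewrite rr.
- move=> y; rewrite inE => /asboolP sy; apply/ffunP => i.
  by rewrite !ffunE /= -sy.
- move=> z _; apply/ffunP => u; rewrite !ffunE /=; have /eqP ru := valP u.
  have -> : h (sval u) = 0 by rewrite -[sval u]ru hr.
  rewrite addr0; congr (z _); apply: val_inj; exact: ru.
Qed.

Lemma affdim_eq (R : realType) (F : set 'rV[R]_n) d :
  has_affdim F d -> affdim F = d.
Proof.
move=> Fd; apply: (has_affdim_unique _ Fd).
by rewrite /affdim; apply: (@xgetPex _ 0%N [set e | has_affdim F e]%classic); exists d.
Qed.

Lemma has_affdim_solved (R : realType) r h :
  (forall i, r (r i) = r i) -> (forall i, h (r i) = 0) ->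
  has_affdim [set x : 'rV[R]_n | solved r h (x 0)]%classic #|[pred i | r i == i]|.
Proof.
move=> rr hr; set A := [pred i | r i == i].
(* [P] reads off the coordinates at the fixed points of [r], and [M] spreads them along [r]. The
   solution set is the translate by [h] of the image of [M], and [M *m P = 1] makes multiplication
   by [M] injective, which gives the dimension. *)
pose M : 'M[R]_(#|A|, n) := \matrix_(a, i) (enum_val a == r i)%:R.
pose P : 'M[R]_(n, #|A|) := \matrix_(i, a) (i == enum_val a)%:R.
have rA i : r i \in A by rewrite inE rr.
have xP (x : 'rV[R]_n) a : (x *m P) 0 a = x 0 (enum_val a).
  rewrite mxE (bigD1 (enum_val a)) //= mxE eqxx mulr1 big1 ?addr0 // => i /negPf e.
  by rewrite mxE e mulr0.
have PM (x : 'rV[R]_n) i : (x *m P *m M) 0 i = x 0 (r i).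
  rewrite mxE; under eq_bigr do rewrite xP mxE.
  rewrite -(big_enum_val (A := A) (fun b => x 0 b * (b == r i)%:R)) (bigD1 (r i)) //=.
  by rewrite eqxx mulr1 big1 ?addr0 // => b /andP[_ /negPf ->]; rewrite mulr0.
have MP : M *m P = 1%:M.
  apply/matrixP => a b; rewrite mxE (bigD1 (enum_val b)) //= big1 ?addr0; last first.
    by move=> i /negPf e; rewrite [P _ _]mxE e mulr0.
  rewrite !mxE eqxx mulr1; have := enum_valP b; rewrite inE => /eqP ->.
  by rewrite (inj_eq enum_val_inj).
pose f : 'Hom('rV[R]_#|A|, 'rV[R]_n) := linfun (mulmxr M).
exists (\row_i (h i)%:~R), (limg f); split.
  apply/seteqP; split=> x /=.
    move=> sx; set y := x - _.
    have -> : y = f (y *m P); last by rewrite memv_img // memvf.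
    rewrite lfunE /=; apply/rowP => i; rewrite PM !mxE hr (sx i).
    by rewrite subr0 addrK.
  move=> /memv_imgP[v _]; rewrite lfunE /= => xv i.
  have vM j : x 0 j - (h j)%:~R = (v *m M) 0 j by rewrite -xv !mxE.
  have := vM (r i); rewrite hr subr0 => ->; apply/eqP; rewrite -subr_eq vM !mxE.
  by apply/eqP; apply: eq_bigr => a _; rewrite !mxE rr.
rewrite limg_dim_eq ?dimvf /dim /= ?mul1n //.
apply/eqP; rewrite -subv0; apply/subvP => v; rewrite memv_cap memv_ker => /andP[_].
by rewrite lfunE /= memv0 => /eqP e; rewrite -[v]mulmx1 -MP mulmxA e mul0mx.
Qed.

Lemma card_sat (R : realType) L :
  let F := [set x : 'rV[R]_n | all (sat (x 0)) L]%classic in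
  exists M, forall K, (M <= K)%N ->
  #|[set y : {ffun 'I_n -> 'I_K.+2} | all (sat y) L]| =
    if F != classical_sets.set0 then (K.+2 ^ affdim F)%N else 0%N.
Proof.
move=> F; have [[r [h [rr hr eqv]]]|[w w0 hw]] := normal_form L.
  exists 0%N => K _.
  have FE : F = [set x : 'rV[R]_n | solved r h (x 0)]%classic.
    by apply/seteqP; split=> x /=; rewrite /F /= => /eqv.
  rewrite ifT; last first.
    apply/set0P; exists (\row_i (h i)%:~R); rewrite FE => i /=.
    by rewrite !mxE hr add0r.
  rewrite FE (affdim_eq (has_affdim_solved R rr hr)) -[in RHS](card_ord K.+2).
  rewrite -(card_solved 'I_K.+2 rr hr); congr #|pred_of_set _|; apply/setP => y; rewrite !inE.
  by apply/idP/asboolP => /eqv.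
(* For [K >= |w|], the integer [w] satisfies [0 < |w| < K + 2], so it is nonzero in Z/(K+2) as well
   as in [R], and neither ring has a solution. *)
exists `|w|%N => K wK; rewrite ifF; last first.
  apply/negbTE/negPn/eqP/seteqP; split=> x //= /hw /eqP.
  by rewrite intr_eq0 => /eqP.
apply/eqP; rewrite cards_eq0; apply/eqP/setP => y; rewrite !inE.
apply/negP => /hw e; apply: w0; apply/eqP; rewrite -absz_eq0.
have {}e : (`|w|%N)%:R = 0 :> 'I_K.+2.
  by case: w e {wK hw} => // m; rewrite NegzE abszN mulrNz => /eqP; rewrite oppr_eq0 => /eqP.
by move: e => /(congr1 val); rewrite Zp_nat /= modn_small ?ltnS 1?ltnW // => ->.
Qed.

End NormalForm.

(** * Points avoiding the arrangement modulo m *)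

(** A triple [(i, j, c)] encodes [x_i = x_j + c] with indices from 0. The three alternatives are C,
    S and I; in the last, [c] is itself a label outside X and below the label [j + 1], whence
    [c <= k] and [c <= j]. *)
Definition in_arr (n k : nat) (t : 'I_n * 'I_n * 'I_n) : bool :=
  let: (i, j, c) := t in
  (i < j)%N && [|| c == 0%N :> nat, (c == 1%N :> nat) && (k <= i)%N
                 | (i == 0%N :> nat) && (c <= minn k j)%N].

Definition arr_eqs (n k : nat) : {set 'I_n * 'I_n * 'I_n} := [set t | in_arr k t].

Lemma Zp_addr_eq0 K (u : 'I_K.+2) (c : nat) : (0 < c <= K.+2)%N ->
  (u + c%:R == 0) = (u + c == K.+2 :> nat)%N.
Proof.
move=> cK; rewrite Zp_nat -val_eqE /= modnDmr; have := ltn_ord u => uK.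
apply/idP/idP => [|/eqP ->]; last by rewrite modnn.
move=> /dvdnP[[|[|q]] e]; lia.
Qed.

Lemma Zp_eq_addr1 K (u v : 'I_K.+2) : (v < K.+1)%N ->
  (u == v + 1) = (u == v.+1 :> nat).
Proof. by move=> vK; rewrite -val_eqE /= modn_small 1?addn1. Qed.

Lemma card_avoid N k K : (0 < k <= N)%N -> (N <= K)%N ->
  #|[set y : {ffun 'I_N.+1 -> 'I_K.+2} | [forall (t | in_arr k t), ~~ sat y t]]| =
    (K.+2 * (K.+2 - N.+1) ^ N)%N.
Proof.
move=> kN NK.
pose D := finset.setX [set: 'I_K.+2]%SET [set w : {ffun 'I_N -> 'I_K.+2} | shi_ish (N.+1 - k) K w].
pose f (y : {ffun 'I_N.+1 -> 'I_K.+2}) : 'I_K.+2 * {ffun 'I_N -> 'I_K.+2} :=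
  (y ord0, [ffun a => (y (lift ord0 a) - y ord0 - 1 : 'I_K.+2)]).
pose g (u : 'I_K.+2 * {ffun 'I_N -> 'I_K.+2}) : {ffun 'I_N.+1 -> 'I_K.+2} :=
  fcons u.1 [ffun a => (u.2 a + u.1 + 1 : 'I_K.+2)].
have fg : cancel f g.
  move=> y; rewrite -[RHS]fcons_tail /g /f /=; congr fcons; apply/ffunP => a.
  by rewrite !ffunE; ring.
have gf : cancel g f.
  move=> [p w]; rewrite /f /g /= fcons0; congr (_, _); apply/ffunP => a.
  by rewrite ffunE fconsS ffunE; ring.
have key p (w : {ffun 'I_N -> 'I_K.+2}) :
    [forall (t | in_arr k t), ~~ sat (g (p, w)) t] = shi_ish (N.+1 - k) K w.
  have g0 : g (p, w) ord0 = p by rewrite /g fcons0.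
  have gS a : g (p, w) (lift ord0 a) = w a + p + 1 by rewrite /g fconsS ffunE.
  (* The values of [c] allowed here run from 0 (the C equation) to [min(k, a + 1)], so avoiding them
     means [w a < K + 1 - min(k, a + 1)]. This is the bound of [shi_ish] for [s = N + 1 - k], as
     then [N - s = k - 1]. *)
  have sat0 a (c : 'I_N.+1) :
      sat (g (p, w)) (ord0, lift ord0 a, c) = (w a + c.+1 == K.+2)%N.
    rewrite -Zp_addr_eq0; last by have := ltn_ord c; lia.
    rewrite /sat /= g0 gS -subr_eq0 -oppr_eq0; congr (_ == 0).
    by rewrite -natr1; ring.
  have satC a b (c : 'I_N.+1) :
      sat (g (p, w)) (lift ord0 a, lift ord0 b, c) = (w a == w b + c%:R).
    rewrite /sat /= !gS -subr_eq0 -[in RHS]subr_eq0; congr (_ == 0); ring.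
  apply/forallP/shi_ishP => [h|[h1 h2] [[i j] c]].
    have bd (a : 'I_N) : (w a < K - minn a (N - (N.+1 - k)))%N.
      rewrite ltnNge; apply/negP => le.
      have := ltn_ord (w a); have := ltn_ord a => aN waK.
      (* A value [w a] beyond the bound satisfies the equation with constant [c = K + 1 - w a]. *)
      have cN : (K.+1 - w a < N.+1)%N by lia.
      have := h (ord0, lift ord0 a, Ordinal cN); rewrite sat0 /= /in_arr /= /bump /=.
      by lia.
    split=> // a b ab; split=> [e|ka].
      have := h (lift ord0 a, lift ord0 b, ord0); rewrite satC /= addr0 /in_arr.
      by rewrite (val_inj e) eqxx /= ltnS ab.
    (* The bound keeps [w b] off the last residue, so that adding 1 does not wrap around and the Shi
       condition modulo m is the one on integers. *)
    have wb : (w b < K.+1)%N by have := bd b; lia.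
    have N1 : (1 < N.+1)%N by lia.
    move=> e; have := h (lift ord0 a, lift ord0 b, Ordinal N1); rewrite satC.
    rewrite Zp_eq_addr1 // e eqxx /in_arr /= /bump /=.
    have := ltn_ord a; lia.
  apply/implyP; rewrite /in_arr => /andP[].
  case: (unliftP ord0 j) => [b|] ->; last by rewrite ltn0.
  case: (unliftP ord0 i) => [a|] ->; last first.
    move=> _; rewrite sat0 lift0 /= => hc; have := h1 b; have := ltn_ord b.
    have := ltn_ord c; lia.
  rewrite !lift0 ltnS satC => ab hc; have [h3 h4] := h2 a b ab.
  case/or3P: hc => [/eqP ->|/andP[/eqP -> ka]|//].
    by rewrite addr0; apply/eqP => e; apply: h3; rewrite e.
  have wb : (w b < K.+1)%N by have := h1 b; lia.
  by rewrite Zp_eq_addr1 //; lia.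
transitivity #|D|.
  apply: (@card_in_can _ _ _ _ f g) => [y|[p w]|y _|u _].
  - by rewrite !inE /= -[in X in X -> _](fg y) key.
  - by rewrite !inE key.
  - exact: fg.
  - exact: gf.
by rewrite cardsX cardsT card_ord card_shi_ish ?leqW // subSS.
Qed.

(** * Hyperplanes and their equations *)

Section Hyperplanes.
Variables (R : realType) (n : nat).

Definition hyp (t : 'I_n * 'I_n * 'I_n) : set 'rV[R]_n :=
  [set x | sat (x 0) t]%classic.

(* The witness is a point of hyp (i, j, c) all of whose coordinates other than
   i and j lie too far apart to satisfy another equation. *)
Lemma hyp_inj : {in [pred t : 'I_n * 'I_n * 'I_n | (t.1.1 < t.1.2)%N] &, injective hyp}.
Proof.
move=> [[i j] c] [[i' j'] c']; rewrite !inE /= => ij ij' e.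
pose v (a : 'I_n) : nat := if a == i then c : nat else if a == j then 0%N else (2 * n * a.+1)%N.
have vi : v i = c by rewrite /v eqxx.
have vj : v j = 0%N by rewrite /v eqxx ifF //; apply/eqP => ji; move: ij; rewrite ji ltnn.
have vo a : a <> i -> a <> j -> v a = (2 * n * a.+1)%N.
  by move=> /eqP /negPf ai /eqP /negPf aj; rewrite /v ai aj.
have : hyp (i, j, c) (\row_a (v a)%:R).
  by rewrite /hyp /= /sat /= !mxE vi vj add0r.
rewrite e /hyp /= /sat /= !mxE -natrD eqr_nat => /eqP {}e.
have := ltn_ord c; have := ltn_ord c'; have := ltn_ord i; have := ltn_ord j.
have := ltn_ord i'; have := ltn_ord j' => *.
have [ii'|ii'] := pselect (i' = i); have [jj'|jj'] := pselect (j' = j).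
- subst i' j'; congr (_, _, _); apply: val_inj => /=; lia.
- have [ji|ji] := pselect (j' = i); first by subst; lia.
  by move: e; rewrite ii' vi (vo j') //; nia.
- have [ji|ji] := pselect (i' = j); first by subst; lia.
  by move: e; rewrite jj' vj (vo i') //; nia.
have [ji|ji] := pselect (i' = j); have [ij''|ij''] := pselect (j' = i).
- by subst; lia.
- by move: e; rewrite ji vj (vo j') //; nia.
- by move: e; rewrite ij'' vi (vo i') //; nia.
by move: e; rewrite !vo //; nia.
Qed.

Lemma arrangementE k : (0 < k < n)%N ->
  arrangement R (open_int n k) = [fset hyp t | t in arr_eqs n k]%fset.
Proof.
move=> kn; apply/fsetP => H; rewrite !inE.
apply/idP/imfsetP => /=.
  case/orP => [/orP[]|] /imfsetP[[i j] /= ij ->].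
  - have {}ij : (i < j)%N := ij.
    have n0 : (0 < n)%N by lia.
    exists (i, j, Ordinal n0); first by rewrite !inE /in_arr ij.
    by apply/seteqP; split=> x; rewrite /hypC /hyp /= /sat /= addr0 => /eqP.
  - have {}ij : (i \in open_int n k) && (i < j)%N := ij; rewrite inE in ij.
    have n1 : (1 < n)%N by have := ltn_ord j; lia.
    exists (i, j, Ordinal n1); first by rewrite !inE /in_arr /=; lia.
    by apply/seteqP; split=> x; rewrite /hypS /hyp /= /sat /= => /eqP.
  (* The label [n] also lies outside X, but [i < j] rules it out, so the constant [i + 1] is at most
     [k]. *)
  - have {}ij : (i \notin open_int n k) && (i < j)%N := ij; rewrite inE in ij.
    have i1 : (i.+1 < n)%N by have := ltn_ord j; lia.
    exists (first_ord j, j, Ordinal i1); first by rewrite !inE /in_arr /=; lia.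
    by apply/seteqP; split=> x; rewrite /hypI /hyp /= /sat /= => /eqP.
move=> [[[i j] c]]; rewrite !inE /in_arr => /andP[ij hc] ->.
have [c0|c0] := eqVneq (c : nat) 0%N.
  apply/orP; left; apply/orP; left; apply/imfsetP; exists (i, j); first exact: ij.
  by apply/seteqP; split=> x; rewrite /hypC /hyp /= /sat /= c0 addr0 => /eqP.
have [i0|i0] := eqVneq (i : nat) 0%N; last first.
  apply/orP; left; apply/orP; right; apply/imfsetP; exists (i, j).
    change ((i \in open_int n k) && (i < j)%N).
    by rewrite inE; have := ltn_ord j; lia.
  have c1 : c = 1%N :> nat by lia.
  by apply/seteqP; split=> x; rewrite /hypS /hyp /= /sat /= c1 => /eqP.
apply/orP; right; apply/imfsetP.
have cn : (c.-1 < n)%N by have := ltn_ord c; lia.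
exists (Ordinal cn, j).
  change ((Ordinal cn \notin open_int n k) && (Ordinal cn < j)%N).
  by rewrite inE /=; have := ltn_ord j; lia.
have -> : i = first_ord j by apply: val_inj.
by apply/seteqP; split=> x; rewrite /hypI /hyp /= /sat /= prednK ?lt0n // => /eqP.
Qed.

End Hyperplanes.

Arguments hyp R {n} t.

(** The sum is the expansion of a product over all [t], whose factor is [-1 + 1 = 0] for [t] in [D]
    and 1 otherwise. *)
Lemma sum_powerset_sign (T : finType) (D : {set T}) :
  \sum_(S : {set T} | S \subset D) (-1) ^+ #|S| = (D == finset.set0)%:R :> int.
Proof.
transitivity (\prod_(t : T) ((if t \in D then -1 else 0) + 1) : int).
  rewrite bigA_distr big_mkcond /=; apply: eq_bigr => S _.
  rewrite -big_mkcond /=; case: ifP => [SD|/negbT /fintype.subsetPn[t tS tD]].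
    rewrite -prodr_const; apply: eq_bigr => t tS.
    by rewrite (fintype.subsetP SD).
  by rewrite (bigD1 t) //= (negPf tD) mul0r.
have [->|[t tD]] := set_0Vmem D.
  by rewrite eqxx big1 // => t _; rewrite inE add0r.
rewrite (bigD1 t) //= tD addNr mul0r; case: eqP => // D0.
by rewrite D0 inE in tD.
Qed.

(** * The characteristic polynomial *)

Section CharPoly.
Variables (R : realType) (n k : nat).
Implicit Types E : {set 'I_n * 'I_n * 'I_n}.

Definition flat E : set 'rV[R]_n := [set x | all (sat (x 0)) (enum E)]%classic.

Definition hyps E : {fset set 'rV[R]_n} := [fset hyp R t | t in E]%fset.

Lemma in_hyps E H : reflect (exists2 t, t \in E & H = hyp R t) (H \in hyps E).
Proof. exact: imfsetP. Qed.

Lemma arr_eqs_hyp_inj : {in arr_eqs n k &, injective (@hyp R n)}.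
Proof.
move=> [[i j] c] [[i' j'] c']; rewrite !inE => /andP[ij _] /andP[ij' _].
exact: hyp_inj.
Qed.

Lemma mem_hyps E t : E \subset arr_eqs n k -> t \in arr_eqs n k ->
  (hyp R t \in hyps E) = (t \in E).
Proof.
move=> /fintype.subsetP sS tA; apply/in_hyps/idP => [[u uS]|tS]; last by exists t.
by move=> /arr_eqs_hyp_inj -> //; exact: sS.
Qed.

Lemma hyps_inj : {in powerset (arr_eqs n k) &, injective hyps}.
Proof.
move=> E E'; rewrite !inE => sS sE' e; apply/setP => t.
have [tA|tA] := boolP (t \in arr_eqs n k); first by rewrite -(mem_hyps sS tA) e mem_hyps.
by rewrite (contraNF (fintype.subsetP sS t) tA) (contraNF (fintype.subsetP sE' t) tA).
Qed.

Lemma card_hyps E : E \subset arr_eqs n k -> #|` hyps E| = #|E|.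
Proof.
move=> /fintype.subsetP sS; rewrite cardE -(size_map (@hyp R n)).
apply: perm_size; apply: uniq_perm; first exact: fset_uniq.
  rewrite map_inj_in_uniq ?enum_uniq // => t u; rewrite !mem_enum => /sS tA /sS uA.
  exact: arr_eqs_hyp_inj.
move=> H; apply/in_hyps/mapP => -[t tS ->]; exists t => //; by rewrite mem_enum in tS *.
Qed.

Lemma intersection_hyps E : intersection (hyps E) = flat E.
Proof.
apply/seteqP; split=> x; rewrite /intersection /flat /= => h.
  apply/allP => t; rewrite mem_enum => tS.
  by apply: (h (hyp R t)); apply/in_hyps; exists t.
move=> H /in_hyps[t tS ->]; apply: (allP h); by rewrite mem_enum.
Qed.

(** Distinct equations of the arrangement define distinct hyperplanes, so subarrangements correspond
    to sets of equations of the same cardinality. Unlike hyperplanes, equations can also be read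
    modulo m. *)
Lemma char_poly_hyps :
  char_poly_arr (hyps (arr_eqs n k)) =
  \sum_(E : {set 'I_n * 'I_n * 'I_n} | E \subset arr_eqs n k)
    (if flat E != classical_sets.set0 then (-1) ^+ #|E| * 'X^(affdim (flat E)) else 0).
Proof.
rewrite /char_poly_arr big_mkcond.
rewrite (perm_big [seq hyps E | E <- enum (powerset (arr_eqs n k))]) /=; last first.
  apply: uniq_perm; first exact: fset_uniq.
    rewrite map_inj_in_uniq ?enum_uniq // => E E'; rewrite !mem_enum.
    exact: hyps_inj.
  move=> B; rewrite fpowersetE; apply/fsubsetP/mapP => [BA|[E]].
    exists [set t in arr_eqs n k | hyp R t \in B]%SET.
      rewrite mem_enum inE; apply/fintype.subsetP => t.
      by rewrite inE => /andP[].
    apply/fsetP => H; apply/idP/in_hyps => [HB|[t]]; last first.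
      by rewrite inE => /andP[_ tB] ->.
    have /in_hyps[t tA e] := BA H HB; exists t => //.
    by rewrite inE tA -e.
  rewrite mem_enum inE => /fintype.subsetP sS -> H /in_hyps[t /sS tA ->].
  by apply/in_hyps; exists t.
rewrite big_map big_enum /=; apply: eq_big => [E|E]; first by rewrite inE.
by rewrite inE => sS; rewrite intersection_hyps card_hyps.
Qed.

Lemma horner_char_poly_hyps : exists M, forall K, (M <= K)%N ->
  (char_poly_arr (hyps (arr_eqs n k))).[K.+2%:R] =
  #|[set y : {ffun 'I_n -> 'I_K.+2} | [forall (t | in_arr k t), ~~ sat y t]]|%:R.
Proof.
have /choice[M hM] := fun E => card_sat R (enum E).
(* One threshold for all of the finitely many subsystems. *)
exists (\max_E M E)%N => K MK.
rewrite char_poly_hyps horner_sum.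
(* Each term at [K + 2] becomes a signed count of the solutions of [E] modulo [K + 2]. After the
   exchange of sums, a point [y] carries the alternating sum over the sets of equations that it
   satisfies, which is 1 if there are none and 0 otherwise. *)
transitivity (\sum_(E : {set 'I_n * 'I_n * 'I_n} | E \subset arr_eqs n k)
  \sum_(y : {ffun 'I_n -> 'I_K.+2} | E \subset [set t | sat y t]) (-1) ^+ #|E| : int).
  apply: eq_bigr => E _.
  have MS : (M E <= K)%N by apply: leq_trans MK; exact: leq_bigmax.
  rewrite sumr_const.
  have -> : #|[pred y : {ffun 'I_n -> 'I_K.+2} | E \subset [set t | sat y t]]| =
            #|[set y : {ffun 'I_n -> 'I_K.+2} | all (sat y) (enum E)]|.
    apply: eq_card => y; rewrite !inE; apply/fintype.subsetP/allP => h t.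
      by rewrite mem_enum => /h; rewrite inE.
    by move=> tS; rewrite inE h // mem_enum.
  rewrite (hM E K MS) -/(flat E); case: ifP => _; last by rewrite horner0.
  rewrite -[RHS]mulr_natr hornerM hornerXn natrX; congr (_ * _).
  by rewrite -polyC1 -polyCN -rmorphXn /= hornerC.
rewrite (exchange_big_dep predT) //=.
transitivity (\sum_(y : {ffun 'I_n -> 'I_K.+2})
  (arr_eqs n k :&: [set t | sat y t] == finset.set0)%:R : int).
  apply: eq_bigr => y _; rewrite -sum_powerset_sign.
  by apply: eq_bigl => E; rewrite finset.subsetI.
rewrite -sum1_card natr_sum big_mkcond [RHS]big_mkcond /=; apply: eq_bigr => y _.
rewrite inE; suff -> : (arr_eqs n k :&: [set t | sat y t] == finset.set0) =
  [forall (t | in_arr k t), ~~ sat y t] by case: ifP.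
apply/eqP/forallP => [/setP e t|h].
  by apply/implyP => tA; have := e t; rewrite !inE tA /= => ->.
apply/setP => t; rewrite !inE; have := h t.
by case: (in_arr k t) => //= /negbTE.
Qed.

End CharPoly.

Lemma poly_eq_at_large (p q : {poly int}) M :
  (forall K, (M <= K)%N -> p.[K.+2%:R] = q.[K.+2%:R]) -> p = q.
Proof.
move=> h; apply/eqP; rewrite -subr_eq0; apply/negPn/negP => pq0.
(* As many distinct roots as the size of [p - q], one more than its degree permits. *)
pose s := [seq (M + i).+2%:R : int | i <- iota 0 (size (p - q))].
have : (size s < size (p - q)%R)%N.
  apply: max_poly_roots => //.
    by apply/allP => _ /mapP[i _ ->]; rewrite rootE hornerD hornerN h ?subrr // leq_addr.
  rewrite map_inj_uniq ?iota_uniq // => i j /eqP; rewrite eqr_nat !eqSS eqn_add2l.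
  by move/eqP.
by rewrite size_map size_iota ltnn.
Qed.

Theorem theorem2p2 (R : realType) (n k : nat) (hn : (3 <= n)%N)
    (hk1 : (1 <= k)%N) (hkn : (k < n)%N) :
  char_poly_arr (arrangement R (open_int n k)) =
  'X * ('X - n%:R%:P) ^+ n.-1.
Proof.
rewrite arrangementE ?hk1 //.
have [M hM] := horner_char_poly_hyps R n k.
(* Besides the finite field threshold, [n <= K] is imposed so that the natural subtraction
   [K + 2 - n] in the point count is the integer one. *)
apply: (@poly_eq_at_large _ _ (maxn M n)) => K; rewrite geq_max => /andP[MK nK].
rewrite hM //.
case: n hn hkn nK {hM} => // N _ hkn nK.
rewrite card_avoid ?hk1 //; last exact: ltnW.
rewrite hornerM hornerX horner_exp hornerD hornerX hornerN hornerC.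
by rewrite natrM natrX natrB //; lia.
Qed.
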